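(* For an integer $N\ge 2$, let $Q_N$ be the sequence generated by the Hofstadter $Q$-recurrence with initial condition $\langle 1,2,3,\ldots,N\rangle$, i.e. $Q_N(i)=i$ for $1\le i\le N$ and $Q_N(n)=Q_N(n-Q_N(n-1))+Q_N(n-Q_N(n-2))$ for $n>N$, with $Q_N$ undefined at nonpositive indices. If $N=8$, $N=11$, $N=12$, or $N\ge 14$, then the sequence $Q_N$ dies. Furthermore, if $N\ge 21$, then $Q_N$ has exactly $N+28$ terms, and if $14\le N\le 20$, then $Q_N$ has exactly $N+32$ terms.
   Context: The Hofstadter $Q$-recurrence is $Q(n)=Q(n-Q(n-1))+Q(n-Q(n-2))$. A sequence generated from an initial condition $\langle a_1,\ldots,a_m\rangle$ has $Q(i)=a_i$ for $1\le i\le m$, and successive terms $Q(m+1),Q(m+2),\ldots$ are computed by the recurrence. The sequence is only defined at positive indices: if computing $Q(n)$ requires the value of $Q$ at a nonpositive index (for instance if $Q(n-1)\ge n$), then $Q(n)$ does not exist, and the sequence is said to die after $n-1$ terms (it is then a finite sequence with exactly $n-1$ terms $Q(1),\ldots,Q(n-1)$). *)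

(* Defs.v *)
From mathcomp Require Import all_boot.

Set Implicit Arguments.
Unset Strict Implicit.
Unset Printing Implicit Defensive.

(* [Qval a n v]: in the sequence generated from the initial condition
   <a_1, ..., a_m>, m = size a, the term Q(n) exists and equals v.  Indices
   start at 1, so a_i is [nth 0 a i.-1].
   The side conditions [x < n] and [y < n] say that the indices n - x and n - y
   are positive, so the truncated subtraction on nat is harmless there.  The
   index n - 2 truncates only for n = 1, where Q(n-1) = Q(0) does not exist.
   As the relation is the least one, it gives no value at index 0, and none
   after the first term that cannot be computed. *)
Inductive Qval (a : seq nat) : nat -> nat -> Prop :=
| Qval_init i : 1 <= i <= size a -> Qval a i (nth 0 a i.-1)
| Qval_rec n x y u v :
    size a < n ->
    Qval a (n - 1) x -> Qval a (n - 2) y ->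
    x < n -> y < n ->
    Qval a (n - x) u -> Qval a (n - y) v ->
    Qval a n (u + v).

Lemma Qval_fun (a : seq nat) (n v w : nat) : Qval a n v -> Qval a n w -> v = w.
Proof.
move=> Hv; elim: Hv w => {n v} [i /andP[_ hi] w Hw|n x y u v hn _ IHx _ IHy _ _ _ IHu _ IHv w Hw].
  inversion Hw as [|n x y u v hn]; first by [].
  by move: hn; rewrite ltnNge hi.
inversion Hw as [j hj|n' x' y' u' v' _ Hx Hy _ _ Hu Hv].
  by move: hn; rewrite ltnNge; case/andP: hj => _ ->.
by rewrite -(IHx _ Hx) in Hu; rewrite -(IHy _ Hy) in Hv; rewrite (IHu _ Hu) (IHv _ Hv).
Qed.

Definition has_exactly_terms (a : seq nat) (k : nat) : Prop :=
  forall n, (exists v, Qval a n v) <-> 1 <= n <= k.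

Definition dies (a : seq nat) : Prop := exists k, has_exactly_terms a k.

(* <1, 2, ..., N> *)
Definition init_cond (N : nat) : seq nat := iota 1 N.

(* Main.v *)
(* For N = m + 21 every value that occurs in the 28 terms after the initial
   condition has the form a * m + c with constants a and c, and every index
   n - Q(n-1), n - Q(n-2) is either of the form m + c or a constant between 1
   and 21, where Q is the identity.  So the 28 steps are one symbolic
   computation, uniform in m; the last value, 2m + 50, exceeds its index m + 49
   and the sequence dies.  The remaining N are single computations. *)
Require Import Defs.
From mathcomp Require Import all_boot zify.

Definition recurrence_at (f : nat -> nat) (n : nat) : bool :=
  [&& 0 < f (n - 1) < n, 0 < f (n - 2) < n &
      f n == f (n - f (n - 1)) + f (n - f (n - 2))].

(** A term exists only if its predecessor does, so failure at index [N + k + 1] excludes all later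
    ones. There the recurrence would need a nonpositive index, since [f (N + k)] exceeds [N + k]. *)
Lemma has_exactly_termsP (N k : nat) (f : nat -> nat) :
  1 < N -> (forall i, 0 < i <= N -> f i = i) ->
  (forall n, N < n <= N + k -> recurrence_at f n) ->
  N + k < f (N + k) -> has_exactly_terms (init_cond N) (N + k).
Proof.
move=> N_gt1 f_init f_rec f_last.
have Qf n : 0 < n <= N + k -> Qval (init_cond N) n (f n).
  elim/ltn_ind: n => n IH n_bd; have [le_nN|lt_Nn] := leqP n N.
    have -> : f n = nth 0 (init_cond N) n.-1.
      by rewrite f_init ?nth_iota; lia.
    by apply: Qval_init; rewrite size_iota; lia.
  have /and3P[x_bd y_bd /eqP ->] : recurrence_at f n by apply: f_rec; lia.
  by apply: (@Qval_rec _ n (f (n - 1)) (f (n - 2)));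
    rewrite ?/init_cond ?size_iota //; try apply: IH; lia.
move=> n; split=> [[v]|n_bd]; last by exists (f n); apply: Qf.
elim=> {n v} [i|n x y u v]; rewrite {1}/init_cond size_iota; first by lia.
move=> lt_Nn Qx IHx _ _ lt_xn _ _ _ _ _.
have [En|] := eqVneq n (N + k).+1; last by lia.
have Qlast : Qval (init_cond N) (n - 1) (f (N + k)).
  by rewrite En subn1; apply: Qf; lia.
by have := Qval_fun Qx Qlast; lia.
Qed.

(* Entry [i] of the list is Q(i); entry 0 is a placeholder. *)
Definition append_term (s : seq nat) : seq nat :=
  let n := size s in
  rcons s (nth 0 s (n - nth 0 s (n - 1)) + nth 0 s (n - nth 0 s (n - 2))).

Definition certifies (N k : nat) (s : seq nat) : bool :=
  [&& 1 < N, all (fun i => nth 0 s i == i) (iota 1 N),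
      all (recurrence_at (nth 0 s)) (iota N.+1 k) & N + k < nth 0 s (N + k)].

Lemma certifies_has_exactly_terms (N k : nat) :
  certifies N k (iter k append_term (iota 0 N.+1)) ->
  has_exactly_terms (init_cond N) (N + k).
Proof.
(* How the list was computed is irrelevant: [certifies] checks every term anew. *)
move: (iter _ _ _) => s /and4P[N_gt1 /allP s_init /allP s_rec s_last].
apply: has_exactly_termsP s_last => // n n_bd.
  by apply/eqP/s_init; rewrite mem_iota; lia.
by apply: s_rec; rewrite mem_iota; lia.
Qed.

(* The pair [(a, c)] stands for [a * m + c]. *)
Definition eval_affine (m : nat) (p : nat * nat) : nat := p.1 * m + p.2.

(* Entry [c] of the list [s] is the symbolic value at index [m + c]; at a
   constant index the sequence is the identity. *)
Definition affine_at (s : seq (nat * nat)) (p : nat * nat) : nat * nat :=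
  if p.1 == 0 then p else nth (0, 0) s p.2.

(** Subtracting [a * m + c] from the index [m + j] leaves [(1 - a) * m + (j - c)]; under
    [affine_admissible] neither difference truncates. *)
Definition affine_step (s : seq (nat * nat)) (j : nat) : nat * nat :=
  let x := nth (0, 0) s (j - 1) in
  let y := nth (0, 0) s (j - 2) in
  let u := affine_at s (1 - x.1, j - x.2) in
  let v := affine_at s (1 - y.1, j - y.2) in
  (u.1 + v.1, u.2 + v.2).

Definition affine_terms : seq (nat * nat) :=
  iter 28 (fun s => rcons s (affine_step s (size s)))
    [seq (1, c) | c <- iota 0 22].

(* Makes [m + j - (a * m + c)] either [m + (j - c)] or a constant in [1, 21]. *)
Definition affine_admissible (j : nat) (p : nat * nat) : bool :=
  (0 < p.2 < j) && ((p.1 == 0) || (p.1 == 1) && (j - p.2 <= 21)).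

Lemma affine_terms_recurrence :
  all (fun j => [&& affine_admissible j (nth (0, 0) affine_terms (j - 1)),
                    affine_admissible j (nth (0, 0) affine_terms (j - 2)) &
                    nth (0, 0) affine_terms j == affine_step affine_terms j])
    (iota 22 28).
Proof. by vm_compute. Qed.

Lemma affine_terms_init c : c <= 21 -> nth (0, 0) affine_terms c = (1, c).
Proof. by do 22?[case: c => [|c]; first by vm_compute]. Qed.

Definition large_term (m n : nat) : nat :=
  if n < m then n else eval_affine m (nth (0, 0) affine_terms (n - m)).

Lemma large_term_addl m c :
  large_term m (m + c) = eval_affine m (nth (0, 0) affine_terms c).
Proof. by rewrite /large_term ltnNge leq_addr addKn. Qed.

Lemma large_term_init m n : n <= m + 21 -> large_term m n = n.
Proof.
rewrite /large_term; case: ltnP => // le_mn n_le.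
by rewrite affine_terms_init /eval_affine /=; lia.
Qed.

Lemma large_term_sub m j p : affine_admissible j p ->
  large_term m (m + j - eval_affine m p) =
  eval_affine m (affine_at affine_terms (1 - p.1, j - p.2)).
Proof.
case: p => a c /andP[/= /andP[c_gt0 lt_cj]] /orP[/eqP -> | /andP[/eqP -> le21]].
  by rewrite /eval_affine mul0n add0n -addnBA ?large_term_addl // ltnW.
(* Here [m] cancels, and the constant index [j - c], at most 21, lies in the initial condition for
   every [m], even for [m = 0]. *)
rewrite /eval_affine mul1n subnDl large_term_init ?mul0n //.
exact: leq_trans le21 (leq_addl _ _).
Qed.

Lemma affine_admissible_bounds m j p : affine_admissible j p ->
  0 < eval_affine m p < m + j.
Proof.
by case: p => a c /andP[/= c_bd] /orP[/eqP -> | /andP[/eqP -> _]];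
  rewrite /eval_affine /=; lia.
Qed.

Lemma large_has_exactly_terms m :
  has_exactly_terms (init_cond (m + 21)) (m + 21 + 28).
Proof.
apply: (@has_exactly_termsP _ _ (large_term m)) => [|i||].
- by rewrite addnC.
- by case/andP=> _; apply: large_term_init.
- move=> n n_bd; have [j En] : exists j, n = m + j by exists (n - m); lia.
  have j_bd : 22 <= j < 50 by lia.
  have /and3P[adm_x adm_y /eqP rec] := allP affine_terms_recurrence j
    ltac:(rewrite mem_iota; lia).
  have sub1 : m + j - 1 = m + (j - 1) by lia.
  have sub2 : m + j - 2 = m + (j - 2) by lia.
  rewrite En /recurrence_at sub1 sub2 !large_term_addl.
  rewrite !affine_admissible_bounds // !large_term_sub // rec.
  by rewrite /eval_affine /= mulnDl addnACA.
- rewrite -addnA large_term_addl.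
  have -> : nth (0, 0) affine_terms (21 + 28) = (2, 50) by vm_compute.
  by rewrite /eval_affine /=; lia.
Qed.

Theorem theorem1 (N : nat) (hN : 2 <= N) :
  ((N = 8 \/ N = 11 \/ N = 12 \/ 14 <= N) -> dies (init_cond N)) /\
  (21 <= N -> has_exactly_terms (init_cond N) (N + 28)) /\
  (14 <= N <= 20 -> has_exactly_terms (init_cond N) (N + 32)).
Proof.
have large : 21 <= N -> has_exactly_terms (init_cond N) (N + 28).
  by move=> leN; rewrite -(subnK leN); apply: large_has_exactly_terms.
have medium : 14 <= N <= 20 -> has_exactly_terms (init_cond N) (N + 32).
  move=> N_bd; apply: certifies_has_exactly_terms.
  have : N \in iota 14 7 by rewrite mem_iota.
  by move: N {hN large N_bd}; apply/allP; vm_compute.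
split=> //; case=> [->|[->|[->|le14]]].
(* The second summands 412, 188 and 57 count the terms computed up to the first value that exceeds
   its index. *)
- by exists (8 + 412); apply: certifies_has_exactly_terms; vm_compute.
- by exists (11 + 188); apply: certifies_has_exactly_terms; vm_compute.
- by exists (12 + 57); apply: certifies_has_exactly_terms; vm_compute.
have [le21|lt21] := leqP 21 N; first by exists (N + 28); apply: large.
by exists (N + 32); apply: medium; rewrite le14.
Qed.
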